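(* Let $P=\{x\in\mathbb{R}^n : Ax=b,\ Dx\le d\}$ be a $0/1$ polytope and consider the linear program $\max\{c^\top x : x\in P\}$, where $A,D,b,d,c$ are integral. Starting from any feasible basis, the Simplex method with the Slim Shadow pivot rule reaches an optimal solution by performing no more than $n$ non-degenerate pivots.
   Context: A $0/1$ polytope is a polytope all of whose extreme points lie in $\{0,1\}^n$. It is assumed that $A$ has full row rank and that the inequalities $x\ge 0$ are among $Dx\le d$. Standard equality form. Adding one slack variable for each inequality of $Dx\le d$ other than the non-negativity constraints gives $\max\{c'^\top x : A'x=b',\ x\ge 0,\ x\in\mathbb{R}^{n'}\}$, with $A'$ of full row rank $m'$ (and $c'$ equal to $c$ extended by zeros). A basis is an ordered set $B=(B(1),\dots,B(m'))$ of column indices with $A'_B$ invertible; $N=[n']\setminus B$. Its basic solution is $x'(B)=A_B'^{-1}b'$, $x'(N)=0$; $B$ is feasible if $x'\ge 0$. The vertex $x$ of $P$ associated to $B$ is obtained from $x'$ by deleting the slack coordinates. Pivot directions and basic cone. For $j\in N$ the pivot direction is $z'^j\in\mathbb{R}^{n'}$ with $z'^j(B)=-A_B'^{-1}A'_j$, $z'^j(j)=1$, $z'^j(i)=0$ for $i\in N\setminus\{j\}$; let $z^j\in\mathbb{R}^n$ be its restriction to the original variables (also called a pivot direction at $B$). The basic cone is $\mathcal{C}(B)=\{z\in\mathbb{R}^n : Az=0,\ D^Bz\le 0\}$, where $D^B$ consists of the rows of $D$ for the constraints $x(j)\ge 0$ with $j\in N$ an original variable and for the inequalities whose slack variable is nonbasic.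 The vectors $z^j$, $j\in N$, generate the extreme rays of $\mathcal{C}(B)$, and $c^\top z^j$ is the reduced cost of $j$. Pivots. At a feasible basis $B$, a pivot with entering index $j\in N$ puts $u=A_B'^{-1}A'_j$, chooses a leaving position $\ell$ attaining $\min_{i:u(i)>0} x'(B(i))/u(i)$, and replaces $B(\ell)$ by $j$. It is non-degenerate if $x'+\varepsilon z'^j$ is feasible for some $\varepsilon>0$ (then the vertex changes to an adjacent one), and degenerate otherwise (then the vertex does not change). The Simplex method stops when $c^\top z^j\le 0$ for all $j\in N$. Slim Shadow pivot rule. Let $x^0$ be the vertex of $P$ associated to the starting basis and let $v=\mathbf{1}-2x^0$, which stays fixed during the whole run. Phase 1: if the starting basis does not satisfy the condition ( * ) for each $z\in\mathcal{C}(B)$, if $c^\top z>0$ then $v^\top z>0$, perform a sequence of degenerate pivots (staying at $x^0$) leading to a basis satisfying ( * ). Phase 2: from then on, at each non-optimal basis $B$ select as pivot direction a $z^j$ maximizing $\frac{c^\top z^j}{v^\top z^j}$ among the pivot directions at $B$ with $c^\top z^j>0$. Ties for the leaving variable are broken lexicographically: fix an ordering of the columns of $A'$ in which the columns of the basis at the start of Phase 2 come first, and choose $\ell$ among $\{i:u(i)>0\}$ so that $\frac{1}{u(\ell)}$ times the $\ell$-th row of $A_B'^{-1}[\,b'\mid A'\,]$ (columns of $A'$ in the fixed order) is lexicographically smallest. *)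

(* Defs.v *)
From HB Require Import structures.
From mathcomp Require Import all_boot all_order all_fingroup all_algebra.
From mathcomp Require Import classical_sets reals topology normedtype.

Set Implicit Arguments.
Unset Strict Implicit.
Unset Printing Implicit Defensive.

Import Order.TTheory GRing.Theory Num.Theory.
Import numFieldNormedType.Exports.

Local Open Scope classical_set_scope.
Local Open Scope ring_scope.

Section Polytope.
Variables (R : realType) (n : nat).

Definition dot (u w : 'cV[R]_n) : R := (u^T *m w) 0 0.

Definition polyhedron m p (A : 'M[R]_(m, n)) (b : 'cV[R]_m)
    (D : 'M[R]_(p, n)) (d : 'cV[R]_p) : set 'cV[R]_n :=
  [set x | A *m x = b /\ forall i, (D *m x) i 0 <= d i 0].

Definition extreme_point (P : set 'cV[R]_n) (x : 'cV[R]_n) : Prop :=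
  P x /\ forall y z t, P y -> P z -> 0 < t < 1 ->
    x = t *: y + (1 - t) *: z -> y = x /\ z = x.

Definition zero_one_vector (x : 'cV[R]_n) : Prop :=
  forall j, x j 0 = 0 \/ x j 0 = 1.

(* Meant for a polyhedron P, for which being a polytope is being bounded. *)
Definition zero_one_polytope (P : set 'cV[R]_n) : Prop :=
  bounded_set P /\ forall x, extreme_point P x -> zero_one_vector x.

Definition optimal_solution (P : set 'cV[R]_n) (c x : 'cV[R]_n) : Prop :=
  P x /\ forall y, P y -> dot c y <= dot c x.

End Polytope.

Section Simplex.
Variables (R : realType) (m n p : nat).
Variables (A : 'M[R]_(m, n)) (b : 'cV[R]_m) (D : 'M[R]_(p, n)) (d : 'cV[R]_p).
Variable c : 'cV[R]_n.

(* Row i of Dx <= d is literally the constraint x(j) >= 0. *)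
Definition nonneg_row (i : 'I_p) (j : 'I_n) : bool :=
  (row i D == - delta_mx 0 j) && (d i 0 == 0).

Definition slack_rows : {set 'I_p} := [set i | ~~ [exists j, nonneg_row i j]].

Local Notation q := #|slack_rows|.

(* The k-th slack variable is column rshift n k of the standard form; it
   belongs to the row slack_row k of Dx <= d. *)
Definition slack_row (k : 'I_q) : 'I_p := enum_val k.

Definition std_A : 'M[R]_(m + q, n + q) :=
  block_mx A 0 (rowsub slack_row D) 1%:M.
Definition std_b : 'cV[R]_(m + q) := col_mx b (rowsub slack_row d).

Definition std_feasible (x' : 'cV[R]_(n + q)) : Prop :=
  std_A *m x' = std_b /\ forall j, 0 <= x' j 0.

Definition std_basis := {ffun 'I_(m + q) -> 'I_(n + q)}.
Implicit Types B : std_basis.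

Definition basis_mx B : 'M[R]_(m + q) := colsub B std_A.
Definition is_basis B : bool := basis_mx B \in unitmx.

(* The vector with entry y(i) at index B(i) and zero at nonbasic indices. *)
Definition at_basis B (y : 'cV[R]_(m + q)) : 'cV[R]_(n + q) :=
  \col_k \sum_(i | B i == k) y i 0.

Definition basic_solution B : 'cV[R]_(n + q) :=
  at_basis B (invmx (basis_mx B) *m std_b).

Definition feasible_basis B : Prop :=
  is_basis B /\ forall j, 0 <= basic_solution B j 0.

Definition vertex B : 'cV[R]_n := usubmx (basic_solution B).

Definition nonbasic B (j : 'I_(n + q)) : bool := j \notin codom B.

Definition pivot_column B (j : 'I_(n + q)) : 'cV[R]_(m + q) :=
  invmx (basis_mx B) *m col j std_A.

Definition std_direction B (j : 'I_(n + q)) : 'cV[R]_(n + q) :=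
  delta_mx j 0 - at_basis B (pivot_column B j).

Definition direction B (j : 'I_(n + q)) : 'cV[R]_n :=
  usubmx (std_direction B j).

(* The last two conditions spell out D^B z <= 0. *)
Definition basic_cone B : set 'cV[R]_n :=
  [set z | [/\ A *m z = 0,
     forall j : 'I_n, nonbasic B (lshift q j) -> 0 <= z j 0
   & forall k : 'I_q, nonbasic B (rshift n k) -> (D *m z) (slack_row k) 0 <= 0]].

Definition improving B (j : 'I_(n + q)) : Prop :=
  nonbasic B j /\ 0 < dot c (direction B j).

Definition simplex_stops B : Prop :=
  forall j, nonbasic B j -> dot c (direction B j) <= 0.

(* Pivot at B with entering index j and leaving position l, resulting in B'. *)
Definition pivot B (j : 'I_(n + q)) (l : 'I_(m + q)) B' : Prop :=
  let u := pivot_column B j in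
  let ratio i := basic_solution B (B i) 0 / u i 0 in
  [/\ feasible_basis B, nonbasic B j,
      0 < u l 0 /\ (forall i, 0 < u i 0 -> ratio l <= ratio i)
    & B' = [ffun i => if i == l then j else B i]].

Definition non_degenerate B (j : 'I_(n + q)) : Prop :=
  exists2 eps : R, 0 < eps &
    std_feasible (basic_solution B + eps *: std_direction B j).

(* run step B k B': a finite sequence of pivots allowed by step leads from B to
   B', and exactly k of them are non-degenerate. *)
Inductive run (step : std_basis -> 'I_(n + q) -> 'I_(m + q) -> std_basis -> Prop)
    (B : std_basis) : nat -> std_basis -> Prop :=
| run_nil : run step B 0 B
| run_degenerate k B1 j l B2 : run step B k B1 ->
    step B1 j l B2 -> ~ non_degenerate B1 j -> run step B k B2
| run_non_degenerate k B1 j l B2 : run step B k B1 ->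
    step B1 j l B2 -> non_degenerate B1 j -> run step B k.+1 B2.

Definition slim_v (B0 : std_basis) : 'cV[R]_n := const_mx 1 - 2 *: vertex B0.

Definition slim_condition (v : 'cV[R]_n) B : Prop :=
  forall z, basic_cone B z -> 0 < dot c z -> 0 < dot v z.

(* A run of arbitrary pivots with count 0 consists of degenerate pivots only. *)
Definition phase1 (B0 B1 : std_basis) : Prop :=
  let v := slim_v B0 in
  (slim_condition v B0 /\ B1 = B0) \/
  [/\ ~ slim_condition v B0, run pivot B0 0 B1 & slim_condition v B1].

(* The column in position k of the ordering is column s k of std_A. *)
Definition basis_first (s : 'S_(n + q)) B : Prop :=
  forall k, (s k \in codom B) = (k < m + q)%N.

(* Since x / 0 = 0 here, the rule is made applicable only if every ratio it
   compares has a nonzero denominator. *)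
Definition slim_entering (v : 'cV[R]_n) B (j : 'I_(n + q)) : Prop :=
  let ratio k := dot c (direction B k) / dot v (direction B k) in
  improving B j /\
  forall k, improving B k -> dot v (direction B k) != 0 /\ ratio k <= ratio j.

(* The row of A'_B^-1 [b' | A'] at position i, with the columns of A' ordered by
   s, divided by the i-th entry of the pivot column. *)
Definition lex_row (s : 'S_(n + q)) B (j : 'I_(n + q)) (i : 'I_(m + q)) :
    (1 + (n + q)).-tuplelexi R :=
  let T := invmx (basis_mx B) *m row_mx std_b (col_perm s std_A) in
  [tuple (pivot_column B j i 0)^-1 * T i k | k < 1 + (n + q)].

Definition lex_leaving (s : 'S_(n + q)) B (j : 'I_(n + q)) (l : 'I_(m + q)) :
    Prop :=
  0 < pivot_column B j l 0 /\
  forall i, 0 < pivot_column B j i 0 -> (lex_row s B j l <= lex_row s B j i)%O.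

Definition slim_pivot (v : 'cV[R]_n) (s : 'S_(n + q)) B (j : 'I_(n + q))
    (l : 'I_(m + q)) B' : Prop :=
  [/\ pivot B j l B', slim_entering v B j & lex_leaving s B j l].

End Simplex.

(* Main.v *)
Require Import Defs.
From HB Require Import structures.
From mathcomp Require Import all_boot all_order all_fingroup all_algebra.
From mathcomp Require Import classical_sets reals topology normedtype.
From mathcomp Require boolp.
From mathcomp Require Import ring lra.

(* Phase 1. For 0/1 points x the value v x - v x0 is the Hamming distance from
   x0 to x, so x0 maximizes c - lam v over the vertices of P once lam exceeds the
   sum of the |c_j|. The lexicographic simplex method for c - lam v therefore
   never leaves x0, and where it stops c z <= lam v z on the basic cone, which
   gives the slim condition.

   Phase 2. Under the slim condition at B, the maximal ratio lam satisfies
   (c - lam v) z <= 0 on the basic cone of B. The entering index has reduced cost 0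
   for c - lam v, so this inequality, hence the slim condition, persists after the
   pivot. Every selected direction thus increases v, and a non-degenerate pivot
   increases the Hamming distance from x0, an integer between 0 and n.

   Termination of both phases: the lexicographic ratio test keeps the tableau
   rows lexicographically positive, and each pivot with positive reduced cost
   then strictly increases the objective row lexicographically. *)

Set Implicit Arguments.
Unset Strict Implicit.
Unset Printing Implicit Defensive.

Import Order.TTheory GRing.Theory Num.Theory.
Import numFieldNormedType.Exports.

Local Open Scope ring_scope.

(** * Lexicographic sign and order of row vectors *)

Section Lexicographic.
Variables (R : realDomainType) (K : nat).
Implicit Types r : 'rV[R]_K.

Definition lex_pos r : Prop :=
  exists2 k : 'I_K, (forall i : 'I_K, (i < k)%N -> r 0 i = 0) & 0 < r 0 k.

Definition lex_tuple r : K.-tuplelexi R := [tuple r 0 k | k < K].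

Lemma lex_tuple_ltP r1 r2 :
  reflect (lex_pos (r2 - r1)) (lex_tuple r1 < lex_tuple r2)%O.
Proof.
apply: (iffP ltxi_tuplePlt) => -[k lt_k pos_k]; exists k.
- by move=> i /lt_k; rewrite !tnth_mktuple !mxE => ->; rewrite subrr.
- by move: pos_k; rewrite !tnth_mktuple !mxE subr_gt0.
- by move=> i /lt_k /eqP; rewrite !tnth_mktuple !mxE subr_eq0 => /eqP.
- by move: pos_k; rewrite !tnth_mktuple !mxE subr_gt0.
Qed.

Lemma lex_tuple_inj : injective lex_tuple.
Proof.
move=> r1 r2 eq_r; apply/rowP => k.
by have := congr1 (fun t => tnth t k) eq_r; rewrite !tnth_mktuple.
Qed.

Lemma lex_posZ a r : 0 < a -> lex_pos r -> lex_pos (a *: r).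
Proof.
move=> a_gt0 [k r0 r_gt0]; exists k => [i /r0|]; rewrite mxE.
  by move=> ->; rewrite mulr0.
by rewrite mulr_gt0.
Qed.

Lemma lex_posD r1 r2 : lex_pos r1 -> lex_pos r2 -> lex_pos (r1 + r2).
Proof.
move=> [k1 z1 p1] [k2 z2 p2].
have [lt12|lt21|eq12] := ltngtP k1 k2.
- exists k1 => [i lt_i|]; rewrite mxE.
    by rewrite z1 // z2 ?addr0 // (ltn_trans lt_i).
  by rewrite z2 ?addr0.
- exists k2 => [i lt_i|]; rewrite mxE.
    by rewrite z2 // z1 ?addr0 // (ltn_trans lt_i).
  by rewrite z1 ?add0r.
- exists k1 => [i lt_i|]; rewrite mxE.
    by rewrite z1 // z2 ?addr0 // -eq12.
  by rewrite (val_inj eq12 : k1 = k2) in p1 *; rewrite addr_gt0.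
Qed.

End Lexicographic.

(** * Dot products on 0/1 vectors and the Hamming distance *)

Section Dot.
Variables (R : realType) (n : nat).
Implicit Types u w x : 'cV[R]_n.

Lemma dotE w x : dot w x = \sum_j w j 0 * x j 0.
Proof. by rewrite /dot mxE; apply: eq_bigr => j _; rewrite mxE. Qed.

Lemma dotDr w x y : dot w (x + y) = dot w x + dot w y.
Proof. by rewrite /dot mulmxDr mxE. Qed.

Lemma dotZr w a x : dot w (a *: x) = a * dot w x.
Proof. by rewrite /dot -scalemxAr mxE. Qed.

Lemma dotBr w x y : dot w (x - y) = dot w x - dot w y.
Proof. by rewrite -scaleN1r dotDr dotZr mulN1r. Qed.

Lemma dot0r w : dot w 0 = 0.
Proof. by rewrite /dot mulmx0 mxE. Qed.

Lemma dotBl u w x : dot (u - w) x = dot u x - dot w x.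
Proof. by rewrite /dot linearB mulmxBl !mxE. Qed.

Lemma dotZl a w x : dot (a *: w) x = a * dot w x.
Proof. by rewrite /dot linearZ -scalemxAl mxE. Qed.

Lemma dot_sumr w (I : finType) (Q : pred I) (f : I -> 'cV[R]_n) :
  dot w (\sum_(i | Q i) f i) = \sum_(i | Q i) dot w (f i).
Proof. by apply: (big_morph (dot w)); [exact: dotDr | exact: dot0r]. Qed.

(** For 0/1 entries, [(1 - 2 x0_j) (x_j - x0_j)] is 1 where the vectors differ and 0 where they
    agree. *)
Lemma dot_hamming x0 x : zero_one_vector x0 -> zero_one_vector x ->
  dot (const_mx 1 - 2 *: x0) (x - x0) = #|[set j | x j 0 != x0 j 0]|%:R.
Proof.
move=> x0_01 x_01; rewrite dotE -sum1_card natr_sum [RHS]big_mkcond /=.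
apply: eq_bigr => j _; rewrite !mxE inE.
by case: (x0_01 j) => ->; case: (x_01 j) => ->;
  rewrite ?eqxx ?oner_eq0 ?(eq_sym 0) ?oner_eq0 /=; ring.
Qed.

(** If [x = x0], both sides vanish. Otherwise the Hamming distance is at least 1, while the left
    side is at most the sum of the [|w_j|]. *)
Lemma dot_le_hamming (w x0 x : 'cV[R]_n) :
  zero_one_vector x0 -> zero_one_vector x ->
  dot w (x - x0) <=
  (1 + \sum_j `|w j 0|) * dot (const_mx 1 - 2 *: x0) (x - x0).
Proof.
move=> x0_01 x_01; rewrite dot_hamming // dotE.
case: (posnP #|[set j | x j 0 != x0 j 0]|) => [card0|card_gt0].
  rewrite card0 mulr0 big1 // => j _; rewrite !mxE.
  have /finset.setP/(_ j) := finset.cards0_eq card0.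
  by rewrite !inE => /negbFE/eqP ->; rewrite subrr mulr0.
apply: (@le_trans _ _ (1 + \sum_j `|w j 0|)); last first.
  by rewrite ler_peMr ?addr_ge0 ?sumr_ge0 // ler1n.
apply: ler_wpDl => //; apply: ler_sum => j _; rewrite !mxE.
apply: le_trans (ler_norm _) _; rewrite normrM ler_piMr //.
by case: (x0_01 j) => ->; case: (x_01 j) => ->;
  rewrite ?subrr ?subr0 ?sub0r ?normrN ?normr0 ?normr1.
Qed.

End Dot.

(** * Standard form, pivot directions, basic cone and vertices *)

Section StandardForm.
Variables (R : realType) (m n p : nat).
Variables (A : 'M[R]_(m, n)) (b : 'cV[R]_m) (D : 'M[R]_(p, n)) (d : 'cV[R]_p).

Local Notation q := #|slack_rows D d|.
Local Notation SA := (std_A A D d).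
Local Notation Sb := (std_b b D d).
Local Notation P := (polyhedron A b D d).
Implicit Types B : std_basis m D d.

(** Applied to [[b' | Y]], this is the simplex tableau at [B]. *)
Definition basis_coords B k (X : 'M[R]_(m + q, k)) : 'M[R]_(m + q, k) :=
  invmx (basis_mx A B) *m X.

Lemma mul_at_basis B y : SA *m at_basis B y = basis_mx A B *m y.
Proof.
apply/colP => i; rewrite !mxE.
under eq_bigr => k _ do rewrite !mxE big_mkcond big_distrr /=.
rewrite exchange_big /=; apply: eq_bigr => l _.
rewrite (bigD1 (B l)) //= eqxx big1 ?addr0 ?mxE // => k /negPf ne_k.
by rewrite eq_sym ne_k mulr0.
Qed.

Lemma at_basis_nonbasic B y j : nonbasic B j -> at_basis B y j 0 = 0.
Proof.
move=> nBj; rewrite mxE big_pred0 // => i.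
by apply: contraNF nBj => /eqP <-; apply: codom_f.
Qed.

Lemma basis_inj B : is_basis A B -> injective B.
Proof.
move=> Bu i i' eqB; apply/eqP/negPn/negP => ne_i.
have e0 : basis_mx A B *m (delta_mx i 0 - delta_mx i' 0) = 0 :> 'cV_(m + q).
  rewrite mulmxBr -!colE; apply/colP => k; rewrite !mxE eqB.
  by rewrite subrr.
have /colP/(_ i) := congr1 (mulmx (invmx (basis_mx A B))) e0.
rewrite mulKmx // mulmx0 !mxE eqxx (negPf ne_i) subr0.
by move/eqP; rewrite oner_eq0.
Qed.

Lemma at_basisE B y i : is_basis A B -> at_basis B y (B i) 0 = y i 0.
Proof.
move=> Bu; rewrite mxE (bigD1 i) //= big1 ?addr0 // => k.
by case/andP=> /eqP /(basis_inj Bu) ->; rewrite eqxx.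
Qed.

(** The difference lies in the kernel of [A'] and is supported on [B], and [A'_B] is invertible.
    Identities between vectors are proved below by comparing nonbasic coordinates only. *)
Lemma basic_unique B (x y : 'cV[R]_(n + q)) : is_basis A B -> SA *m x = SA *m y ->
  (forall j, nonbasic B j -> x j 0 = y j 0) -> x = y.
Proof.
move=> Bu eqxy eqN; apply/eqP; rewrite -subr_eq0; apply/eqP.
set z := x - y.
have zN j : nonbasic B j -> z j 0 = 0.
  by move=> /eqN; rewrite !mxE => ->; rewrite subrr.
have zB : z = at_basis B (\col_i z (B i) 0).
  apply/colP => j; have [/codomP[i ->]|nBj] := boolP (j \in codom B).
    by rewrite at_basisE // [RHS]mxE.
  by rewrite zN // at_basis_nonbasic.
have z0 : basis_mx A B *m (\col_i z (B i) 0) = 0.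
  by rewrite -mul_at_basis -zB mulmxBr eqxy subrr.
have := congr1 (mulmx (invmx (basis_mx A B))) z0.
rewrite mulKmx // mulmx0 => y0; rewrite zB y0; apply/colP => j.
by rewrite !mxE big1 // => i _; rewrite mxE.
Qed.

Lemma std_direction_ker B j : is_basis A B -> SA *m std_direction A B j = 0.
Proof. by move=> Bu; rewrite mulmxBr mul_at_basis mulKVmx // -colE subrr. Qed.

Lemma std_direction_nonbasic B j k : nonbasic B k ->
  std_direction A B j k 0 = (k == j)%:R.
Proof.
by move=> nBk; rewrite mxE [X in _ + X]mxE at_basis_nonbasic // subr0 !mxE andbT.
Qed.

Lemma std_direction_basic B j i : is_basis A B -> nonbasic B j ->
  std_direction A B j (B i) 0 = - pivot_column A B j i 0.
Proof.
move=> Bu nBj; rewrite mxE [X in _ + X]mxE at_basisE // mxE andbT.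
by case: eqP nBj => [<-|_ _]; rewrite ?sub0r // /nonbasic codom_f.
Qed.

Lemma mul_basic_solution B : is_basis A B -> SA *m basic_solution A b B = Sb.
Proof. by move=> Bu; rewrite mul_at_basis mulKVmx. Qed.

Lemma basic_solution_nonbasic B j : nonbasic B j -> basic_solution A b B j 0 = 0.
Proof. exact: at_basis_nonbasic. Qed.

Lemma basic_solution_basic B i : is_basis A B ->
  basic_solution A b B (B i) 0 = basis_coords B Sb i 0.
Proof. by move=> Bu; rewrite at_basisE. Qed.

Lemma ker_decomposition B (y : 'cV[R]_(n + q)) : is_basis A B -> SA *m y = 0 ->
  y = \sum_(j | nonbasic B j) y j 0 *: std_direction A B j.
Proof.
move=> Bu y0; apply: (@basic_unique B) => //.
  rewrite y0 mulmx_sumr big1 // => j _.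
  by rewrite -scalemxAr std_direction_ker // scaler0.
move=> k nBk; rewrite summxE (bigD1 k) //= big1 => [|j /andP[_ ne_j]].
  by rewrite mxE std_direction_nonbasic // eqxx mulr1 addr0.
by rewrite mxE std_direction_nonbasic // eq_sym (negPf ne_j) mulr0.
Qed.

(** The expansion in reduced costs: optimality and bounds on the basic cone follow from it by
    checking signs term by term. *)
Lemma dot_ker w B (y : 'cV[R]_(n + q)) : is_basis A B -> SA *m y = 0 ->
  dot w (usubmx y) = \sum_(j | nonbasic B j) y j 0 * dot w (direction A B j).
Proof.
move=> Bu y0; rewrite {1}(ker_decomposition Bu y0) linear_sum dot_sumr.
by apply: eq_bigr => j _; rewrite linearZ dotZr.
Qed.

(** The slack part is [r - D x]: [r = d] lifts points of the polyhedron, [r = 0] lifts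
    directions. *)
Definition std_lift (x : 'cV[R]_n) (r : 'cV[R]_p) : 'cV[R]_(n + q) :=
  col_mx x (rowsub (@slack_row _ _ _ D d) (r - D *m x)).

Lemma mul_lift x r :
  SA *m std_lift x r = col_mx (A *m x) (rowsub (@slack_row _ _ _ D d) r).
Proof.
rewrite mul_block_col mul0mx addr0 mul1mx; congr col_mx.
by rewrite mul_rowsub_mx; apply/colP => i; rewrite !mxE addrC subrK.
Qed.

Lemma lift_usubmx x' : SA *m x' = Sb -> x' = std_lift (usubmx x') d.
Proof.
rewrite -{1}[x']vsubmxK mul_block_col mul0mx addr0 mul1mx => /eq_col_mx[_ eqd].
rewrite -{1}[x']vsubmxK /std_lift; congr col_mx.
apply/colP => i; move/colP/(_ i): eqd; rewrite mul_rowsub_mx !mxE => <-.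
by rewrite [RHS]addrAC subrr add0r.
Qed.

Lemma std_feasible_lift x : (forall j : 'I_n, exists i : 'I_p, nonneg_row D d i j) ->
  P x -> std_feasible A b (std_lift x d).
Proof.
move=> nonneg [Ax Dx]; split; first by rewrite mul_lift Ax.
move=> j; rewrite mxE; case: splitP => k _.
  have [i /andP[/eqP rowi /eqP di]] := nonneg k.
  have := Dx i; rewrite di.
  have -> : (D *m x) i 0 = (row i D *m x) 0 0 by rewrite -row_mul [RHS]mxE.
  rewrite rowi mulNmx -rowE !mxE; lra.
by rewrite !mxE subr_ge0; have := Dx (slack_row k); rewrite mxE.
Qed.

Lemma usubmx_feasible (x' : 'cV[R]_(n + q)) : std_feasible A b x' -> P (usubmx x').
Proof.
move=> [eqx x_ge0]; have x_lift := lift_usubmx eqx; split.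
  by move: eqx; rewrite {1}x_lift mul_lift => /eq_col_mx[].
move=> i; have [i_slack|] := boolP (i \in slack_rows D d).
  have := x_ge0 (rshift n (enum_rank_in i_slack i)).
  rewrite x_lift col_mxEd !mxE /slack_row enum_rankK_in //.
  by rewrite -x_lift subr_ge0.
rewrite inE negbK => /existsP[j /andP[/eqP rowi /eqP ->]].
have -> : (D *m usubmx x') i 0 = (row i D *m usubmx x') 0 0.
  by rewrite -row_mul [RHS]mxE.
by rewrite rowi mulNmx -rowE !mxE oppr_le0.
Qed.

(** For a direction the slack of a row is [- D z], so both sign conditions of the cone become
    nonnegativity of nonbasic coordinates. *)
Lemma cone_lift B z : basic_cone A B z ->
  exists y : 'cV[R]_(n + q), [/\ SA *m y = 0, usubmx y = z
    & forall j, nonbasic B j -> 0 <= y j 0].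
Proof.
move=> [Az zN zS]; exists (std_lift z 0); split.
- rewrite mul_lift Az; apply/colP => i; rewrite mxE.
  by case: split => k; rewrite !mxE.
- by rewrite col_mxKu.
- move=> j; rewrite -[j]splitK; case: (split j) => k /= nBk.
    by rewrite col_mxEu zN.
  by rewrite col_mxEd sub0r mxE mxE oppr_ge0 zS.
Qed.

Lemma cone_std B (y : 'cV[R]_(n + q)) :
  SA *m y = 0 -> (forall j, nonbasic B j -> 0 <= y j 0) ->
  basic_cone A B (usubmx y).
Proof.
rewrite -{1}[y]vsubmxK mul_block_col mul0mx addr0 mul1mx => eq0 yN.
have [Ay Sy] : A *m usubmx y = 0 /\
    rowsub (@slack_row _ _ _ D d) D *m usubmx y + dsubmx y = 0.
  apply: eq_col_mx; rewrite eq0; apply/colP => i.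
  by rewrite !mxE; case: split => k; rewrite mxE.
split=> // [j /yN|k /yN]; first by rewrite mxE.
by move/colP/(_ k): Sy; rewrite mul_rowsub_mx !mxE; lra.
Qed.

Lemma direction_cone B j : is_basis A B -> basic_cone A B (direction A B j).
Proof.
move=> Bu; apply: cone_std => [|k nBk]; first exact: std_direction_ker.
by rewrite std_direction_nonbasic ?ler0n.
Qed.

Lemma feasible_std B : feasible_basis A b B -> std_feasible A b (basic_solution A b B).
Proof. by move=> [Bu x_ge0]; split=> //; apply: mul_basic_solution. Qed.

(** Nonbasic coordinates of the basic solution vanish. In a proper convex combination of nonnegative
    points they then vanish at both points, and [basic_unique] applies. *)
Lemma vertex_extreme B : (forall j : 'I_n, exists i : 'I_p, nonneg_row D d i j) ->
  feasible_basis A b B -> extreme_point P (vertex A b B).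
Proof.
move=> nonneg Bf; have [Bu _] := Bf.
have [eqx _] := feasible_std Bf.
split; first exact: usubmx_feasible (feasible_std Bf).
have key y z t : P y -> P z -> 0 < t < 1 ->
    vertex A b B = t *: y + (1 - t) *: z -> y = vertex A b B.
  move=> Py Pz /andP[t_gt0 t_lt1] eqv.
  have [eqy y_ge0] := std_feasible_lift nonneg Py.
  have [eqz z_ge0] := std_feasible_lift nonneg Pz.
  have eqs : basic_solution A b B = t *: std_lift y d + (1 - t) *: std_lift z d.
    rewrite (lift_usubmx eqx) -/(vertex A b B) eqv /std_lift !scale_col_mx add_col_mx.
    congr col_mx; rewrite mulmxDr -!scalemxAr; apply/colP => i.
    by rewrite !mxE; ring.
  have eq_y : std_lift y d = basic_solution A b B; last first.
    by rewrite /vertex -eq_y col_mxKu.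
  apply: (@basic_unique B) => // [|j nBj]; first by rewrite eqx.
  rewrite basic_solution_nonbasic //; apply/eqP.
  have /eqP := basic_solution_nonbasic nBj.
  rewrite eqs mxE [X in X + _]mxE [X in _ + X]mxE paddr_eq0.
  - by rewrite mulf_eq0 gt_eqF //= => /andP[].
  - by rewrite mulr_ge0 ?y_ge0 // ltW.
  - by rewrite mulr_ge0 ?z_ge0 // subr_ge0 ltW.
move=> y z t Py Pz t01 eqv; split; first exact: key eqv.
apply: (key z y (1 - t)) => //; last by rewrite subKr addrC.
by move: t01; lra.
Qed.

(** The basic solution is 0 at nonbasic indices, so the displacement to a feasible point has
    nonnegative nonbasic coordinates, each weighted by a nonpositive reduced cost. *)
Lemma stops_optimal w B : (forall j : 'I_n, exists i : 'I_p, nonneg_row D d i j) ->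
  feasible_basis A b B -> simplex_stops A w B -> optimal_solution P w (vertex A b B).
Proof.
move=> nonneg Bf stop; have [Bu _] := Bf; have [eqx _] := feasible_std Bf.
split; first exact: usubmx_feasible (feasible_std Bf).
move=> y Py; have [eqy y_ge0] := std_feasible_lift nonneg Py.
rewrite -subr_le0 -dotBr.
have -> : y - vertex A b B = usubmx (std_lift y d - basic_solution A b B).
  by rewrite linearB /= col_mxKu.
rewrite (dot_ker _ Bu); last by rewrite mulmxBr eqx eqy subrr.
apply: sumr_le0 => j nBj; apply: mulr_ge0_le0; last exact: stop.
by rewrite mxE [X in _ + X]mxE basic_solution_nonbasic // subr0.
Qed.

End StandardForm.

(** * The effect of a pivot on the basis, the tableau and the vertex *)

Section Pivoting.
Variables (R : realType) (m n p : nat).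
Variables (A : 'M[R]_(m, n)) (b : 'cV[R]_m) (D : 'M[R]_(p, n)) (d : 'cV[R]_p).

Local Notation q := #|slack_rows D d|.
Local Notation SA := (std_A A D d).
Local Notation Sb := (std_b b D d).
Local Notation P := (polyhedron A b D d).
Implicit Types (B : std_basis m D d) (j : 'I_(n + q)) (l : 'I_(m + q)).

Lemma basis_coords_col B K (X : 'M[R]_(m + q, K)) k :
  col k (basis_coords A B X) = basis_coords A B (col k X).
Proof. by rewrite !colE -mulmxA. Qed.

Definition pivoted B j l : std_basis m D d := [ffun i => if i == l then j else B i].

Lemma pivoted_nonbasic B j l k : nonbasic (pivoted B j l) k ->
  k != j /\ (k = B l \/ nonbasic B k).
Proof.
move=> nk; split.
  apply: contraNneq nk => ->; apply/codomP; exists l.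
  by rewrite ffunE eqxx.
have [/codomP[i eqk]|] := boolP (k \in codom B); last by right.
left; rewrite eqk; congr (B _); apply: contraNeq nk => ne_il.
by apply/codomP; exists i; rewrite ffunE (negPf ne_il).
Qed.

Lemma nonbasic_pivoted B j l k : nonbasic B k -> k != j -> nonbasic (pivoted B j l) k.
Proof.
move=> nk ne_kj; apply: contra nk => /codomP[i]; rewrite ffunE.
by case: ifP => [_ eqk|_ ->]; rewrite ?codom_f // eqk eqxx in ne_kj *.
Qed.

Lemma is_basis_pivoted B j l : is_basis A B -> pivot_column A B j l 0 != 0 ->
  is_basis A (pivoted B j l).
Proof.
move=> Bu; set u := pivot_column A B j => ul0.
pose W := invmx (basis_mx A B) *m basis_mx A (pivoted B j l).
have WE i k : W i k = if k == l then u i 0 else (i == k)%:R.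
  have -> : W i k = (invmx (basis_mx A B) *m col k (basis_mx A (pivoted B j l))) i 0.
    by rewrite -/(basis_coords _ _ _) -basis_coords_col [RHS]mxE.
  have [->|/negPf ne_kl] := eqVneq k l.
    by congr ((_ *m _) i 0); apply/colP => h; rewrite !mxE ffunE eqxx.
  have -> : col k (basis_mx A (pivoted B j l)) = col k (basis_mx A B).
    by apply/colP => h; rewrite !mxE ffunE ne_kl.
  by rewrite -/(basis_coords _ _ _) -basis_coords_col /basis_coords mulVmx // !mxE.
(* [W] is the identity with column [l] replaced by [u]; as [u_l] is nonzero, a rank-one correction
   of the identity inverts it. *)
have W1 : (1%:M - ((u l 0)^-1 *: (u - delta_mx l 0)) *m
    (delta_mx 0 l : 'rV_(m + q))) *m W = 1%:M.
  rewrite mulmxBl mul1mx -mulmxA -rowE.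
  move: ul0 WE; move: (W) (u) => V v vl0 VE; apply/matrixP => i k.
  rewrite !mxE big_ord1 !mxE !VE; have [->|ne_kl] := eqVneq k l.
    by rewrite andbT mulrAC mulVf // mul1r subKr.
  by rewrite mulr0 subr0.
have [_] := mulmx1_unit W1.
by rewrite unitmx_mul => /andP[].
Qed.

(* The update holds for every right-hand side r, not only b': applied to the
   columns of a tableau, it also yields the new rows and the new objective row. *)
Lemma at_basis_pivoted B j l (r : 'cV[R]_(m + q)) :
  is_basis A B -> nonbasic B j -> pivot_column A B j l 0 != 0 ->
  at_basis (pivoted B j l) (basis_coords A (pivoted B j l) r) =
  at_basis B (basis_coords A B r) +
    (basis_coords A B r l 0 / pivot_column A B j l 0) *: std_direction A B j.
Proof.
move=> Bu nBj ul0; have B'u := is_basis_pivoted Bu ul0.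
apply: (basic_unique B'u) => [|k nk].
  rewrite mulmxDr -scalemxAr std_direction_ker // scaler0 addr0.
  by rewrite !mul_at_basis !mulKVmx.
rewrite at_basis_nonbasic // mxE [X in _ + X]mxE.
have [ne_kj [->|nBk]] := pivoted_nonbasic nk.
  by rewrite (at_basisE _ _ Bu) std_direction_basic // mulrN divfK // subrr.
by rewrite at_basis_nonbasic // std_direction_nonbasic // (negPf ne_kj) mulr0 addr0.
Qed.

(** This is [at_basis_pivoted] on each column, read at the new basic indices: position [l] holds
    [j], where the direction is 1, and any other position [i] holds [B i], where it is [- u_i]. *)
Lemma basis_coords_pivoted B j l K (X : 'M[R]_(m + q, K)) i :
  is_basis A B -> nonbasic B j -> pivot_column A B j l 0 != 0 ->
  row i (basis_coords A (pivoted B j l) X) =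
  if i == l then (pivot_column A B j l 0)^-1 *: row l (basis_coords A B X)
  else row i (basis_coords A B X) -
    (pivot_column A B j i 0 / pivot_column A B j l 0) *: row l (basis_coords A B X).
Proof.
move=> Bu nBj ul0; have B'u := is_basis_pivoted Bu ul0.
apply/rowP => k.
have colE (B' : std_basis m D d) h :
    basis_coords A B' X h k = basis_coords A B' (col k X) h 0.
  by rewrite -basis_coords_col [RHS]mxE.
rewrite mxE colE -(at_basisE (basis_coords A (pivoted B j l) (col k X)) i B'u).
rewrite at_basis_pivoted // mxE [X in _ + X]mxE ffunE.
case: (i == l).
  rewrite at_basis_nonbasic // std_direction_nonbasic // eqxx add0r mulr1.
  by rewrite [RHS]mxE [X in _ = _ * X]mxE colE mulrC.
rewrite (at_basisE _ _ Bu) std_direction_basic // [RHS]mxE [X in _ = X + _]mxE.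
rewrite [X in _ = _ + X]mxE [X in _ = _ - X]mxE [X in _ = _ - _ * X]mxE !colE.
by ring.
Qed.

Definition min_ratio B j l : Prop :=
  let u := pivot_column A B j in
  let ratio i := basic_solution A b B (B i) 0 / u i 0 in
  0 < u l 0 /\ (forall i, 0 < u i 0 -> ratio l <= ratio i).

Definition step_length B j l : R :=
  basic_solution A b B (B l) 0 / pivot_column A B j l 0.

Lemma step_length_ge0 B j l : feasible_basis A b B -> min_ratio B j l ->
  0 <= step_length B j l.
Proof. by move=> [_ x_ge0] [ul _]; rewrite divr_ge0 // ltW. Qed.

Lemma basic_solution_pivoted B j l :
  is_basis A B -> nonbasic B j -> pivot_column A B j l 0 != 0 ->
  basic_solution A b (pivoted B j l) =
  basic_solution A b B + step_length B j l *: std_direction A B j.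
Proof.
move=> Bu nBj ul0; rewrite [LHS]at_basis_pivoted //.
by rewrite /step_length basic_solution_basic.
Qed.

Lemma vertex_pivoted B j l :
  is_basis A B -> nonbasic B j -> pivot_column A B j l 0 != 0 ->
  vertex A b (pivoted B j l) = vertex A b B + step_length B j l *: direction A B j.
Proof. by move=> *; rewrite /vertex basic_solution_pivoted // linearD linearZ. Qed.

Lemma feasible_pivoted B j l : feasible_basis A b B -> nonbasic B j ->
  min_ratio B j l -> feasible_basis A b (pivoted B j l).
Proof.
move=> Bf nBj min_l; have [Bu x_ge0] := Bf; have [ul_gt0 ul_min] := min_l.
have ul0 : pivot_column A B j l 0 != 0 by rewrite gt_eqF.
split=> [|k]; first exact: is_basis_pivoted.
rewrite basic_solution_pivoted // mxE [X in _ + X]mxE.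
have theta_ge0 := step_length_ge0 Bf min_l.
have [/codomP[i ->]|nBk] := boolP (k \in codom B); last first.
  rewrite std_direction_nonbasic // basic_solution_nonbasic // add0r.
  by rewrite mulr_ge0 // ler0n.
rewrite std_direction_basic // mulrN subr_ge0.
have [ui_le0|ui_gt0] := leP (pivot_column A B j i 0) 0.
  by apply: le_trans (x_ge0 (B i)); apply: mulr_ge0_le0.
by rewrite -ler_pdivlMr // ul_min.
Qed.

(** Moving by [eps] lowers coordinate [B l] by [eps * u_l] and keeps it nonnegative, so the step
    length is at least [eps]. *)
Lemma non_degenerate_step B j l : is_basis A B -> nonbasic B j ->
  0 < pivot_column A B j l 0 -> non_degenerate A b B j -> 0 < step_length B j l.
Proof.
move=> Bu nBj ul_gt0 [eps eps_gt0 [_ /(_ (B l))]].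
rewrite mxE [X in _ + X]mxE std_direction_basic // mulrN subr_ge0 -ler_pdivlMr //.
exact: lt_le_trans.
Qed.

(** Without a positive entry the whole ray along the direction stays feasible, against boundedness.
    The positive [w]-value ensures that the direction is nonzero. *)
Lemma exists_leaving w B j : bounded_set P -> feasible_basis A b B ->
  nonbasic B j -> 0 < dot w (direction A B j) ->
  exists l, 0 < pivot_column A B j l 0.
Proof.
move=> bP Bf nBj wz_gt0; have [Bu x_ge0] := Bf.
have [/existsP[l]|/existsPn no_l] := boolP [exists l, 0 < pivot_column A B j l 0].
  by exists l.
have ray t : 0 <= t -> P (vertex A b B + t *: direction A B j).
  move=> t_ge0; rewrite /direction -linearZ -linearD; apply: usubmx_feasible; split.
    by rewrite mulmxDr -scalemxAr std_direction_ker // scaler0 addr0 mul_basic_solution.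
  move=> k; rewrite mxE [X in _ + X]mxE addr_ge0 // mulr_ge0 //.
  have [/codomP[i ->]|nBk] := boolP (k \in codom B).
    by rewrite std_direction_basic // oppr_ge0 leNgt.
  by rewrite std_direction_nonbasic ?ler0n.
have [M M_gt0 /= P_le] := pinfty_ex_gt0 bP.
have z_gt0 : 0 < `|direction A B j|.
  by rewrite normr_gt0; apply: contraTneq wz_gt0 => ->; rewrite dot0r ltxx.
(* This moves the point by norm [2M + 1], while two points of norm at most [M] are at distance at
   most [2M]. *)
pose t := (M + M + 1) / `|direction A B j|.
have t_ge0 : 0 <= t by rewrite divr_ge0 // ltW //; lra.
have := P_le _ (ray t t_ge0); have := P_le _ (ray 0 (lexx 0)).
rewrite scale0r addr0 => le0 le_t.
have := ler_normB (vertex A b B + t *: direction A B j) (vertex A b B).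
rewrite addrAC subrr add0r normrZ ger0_norm // /t divfK ?gt_eqF //.
lra.
Qed.

(** * The lexicographic ratio test and its termination measure *)

Section LexPivot.
Variables (K : nat) (Y : 'M[R]_(m + q, K)).
Local Notation X := (row_mx Sb Y).
Local Notation T B := (basis_coords A B X).

(** [Y] stays general because the phases break ties by different columns: those of the starting
    basis in Phase 1, all columns of [A'] in the order [s] in Phase 2. *)
Definition lex_feasible B : Prop := forall i, lex_pos (row i (T B)).

Definition lex_min B j l : Prop :=
  let u := pivot_column A B j in
  let lex i := lex_tuple ((u i 0)^-1 *: row i (T B)) in
  0 < u l 0 /\ forall i, 0 < u i 0 -> (lex l <= lex i)%O.

Lemma lex_min_exists B j l : 0 < pivot_column A B j l 0 -> exists l', lex_min B j l'.
Proof.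
move=> ul; pose u := pivot_column A B j.
pose lex i := lex_tuple ((u i 0)^-1 *: row i (T B)).
have := @arg_minP _ _ _ l (fun i => 0 < u i 0) lex ul.
by case=> l' ul' l'_min; exists l'.
Qed.

Lemma row0_coords B i :
  is_basis A B -> T B i (lshift K 0) = basic_solution A b B (B i) 0.
Proof.
by move=> Bu; rewrite basic_solution_basic // /basis_coords mul_mx_row row_mxEl.
Qed.

(** The column [b'] comes first, so the leading entries compared are the ratios of the ordinary
    test. *)
Lemma lex_min_ratio B j l : is_basis A B -> lex_min B j l -> min_ratio B j l.
Proof.
move=> Bu [ul l_min]; split=> // i ui; rewrite leNgt; apply/negP => lt_il.
have := l_min i ui; rewrite leNgt => /negP; apply.
apply/lex_tuple_ltP; exists (lshift K 0) => [//|].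
have scale_row a h : (a *: row h (T B)) 0 (lshift K 0) =
    a * basic_solution A b B (B h) 0 by rewrite mxE [X in _ * X]mxE row0_coords.
by rewrite mxE [X in _ + X]mxE !scale_row subr_gt0 ![_^-1 * _]mulrC.
Qed.

(** If [u_i < 0], a positive multiple of a positive row is added to row [i]. If [u_i > 0], the new
    row is a positive multiple of the difference of two scaled rows, positive because the minimizer
    is unique. *)
Lemma lex_feasible_pivoted B j l : row_free X -> is_basis A B -> nonbasic B j ->
  lex_feasible B -> lex_min B j l -> lex_feasible (pivoted B j l).
Proof.
move=> Xfree Bu nBj Blex [ul l_min] i.
have ul0 : pivot_column A B j l 0 != 0 by rewrite gt_eqF.
rewrite basis_coords_pivoted //; have [_|ne_il] := eqVneq i l.
  by apply: lex_posZ; rewrite ?invr_gt0.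
set u := pivot_column A B j in ul l_min ul0 *.
have [ui_lt0|ui_gt0|ui0] := ltgtP (u i 0) 0; last first.
- by rewrite ui0 mul0r scale0r subr0.
- have -> : row i (T B) - (u i 0 / u l 0) *: row l (T B) =
      u i 0 *: ((u i 0)^-1 *: row i (T B) - (u l 0)^-1 *: row l (T B)).
    by rewrite scalerBr !scalerA divff ?scale1r // gt_eqF.
  apply: lex_posZ => //; apply/lex_tuple_ltP.
  rewrite lt_neqAle l_min // andbT; apply/eqP => /lex_tuple_inj eq_rows.
  (* Independent tableau rows are never proportional, which excludes ties. *)
  have Tfree : row_free (T B).
    by rewrite /row_free mxrankMfree // -/(row_free _) row_free_unit unitmx_inv.
  have delta_free (a c : R) :
      a *: delta_mx 0 l = c *: delta_mx 0 i :> 'rV_(m + q) -> a = 0.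
    by move/rowP/(_ l); rewrite !mxE !eqxx (eq_sym l) (negPf ne_il) mulr1 mulr0.
  have /delta_free/eqP :
      (u l 0)^-1 *: delta_mx 0 l = (u i 0)^-1 *: delta_mx 0 i :> 'rV_(m + q).
    by apply: (row_free_inj Tfree); rewrite -!scalemxAl -!rowE.
  by rewrite invr_eq0; apply/negP.
- rewrite -scaleNr; apply: lex_posD => //; apply: lex_posZ => //.
  by rewrite -mulNr divr_gt0 // oppr_gt0.
Qed.

(** The objective row of the tableau; its first entry is the [w]-value of the vertex. *)
Definition lex_objective w B : (1 + K).-tuplelexi R :=
  lex_tuple (\row_k dot w (usubmx (at_basis B (col k (T B))))).

(** By [at_basis_pivoted] on each column, the objective row gains a positive multiple of row [l],
    which is lexicographically positive. *)
Lemma lex_objective_pivoted w B j l : is_basis A B -> nonbasic B j ->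
  lex_feasible B -> lex_min B j l -> 0 < dot w (direction A B j) ->
  (lex_objective w B < lex_objective w (pivoted B j l))%O.
Proof.
move=> Bu nBj Blex [ul l_min] wz_gt0; apply/lex_tuple_ltP.
have ul0 : pivot_column A B j l 0 != 0 by rewrite gt_eqF.
suff -> : \row_k dot w (usubmx (at_basis (pivoted B j l) (col k (T (pivoted B j l)))))
    - \row_k dot w (usubmx (at_basis B (col k (T B)))) =
    (dot w (direction A B j) / pivot_column A B j l 0) *: row l (T B).
  by apply: lex_posZ; rewrite ?divr_gt0.
apply/rowP => k; rewrite [LHS]mxE [X in X + _]mxE [X in _ + X]mxE [X in _ - X]mxE.
rewrite [RHS]mxE [X in _ * X]mxE !basis_coords_col at_basis_pivoted //.
rewrite linearD linearZ dotDr dotZr addrAC subrr add0r.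
by rewrite -basis_coords_col [X in X / _ * _]mxE; ring.
Qed.

(** Turns an increasing objective row into a decreasing natural number: index tuples [B'],
    invertible or not, are finitely many. *)
Definition lex_rank w B : nat :=
  #|[set B' : std_basis m D d | (lex_objective w B < lex_objective w B')%O]|.

Lemma lex_rank_pivoted w B j l : is_basis A B -> nonbasic B j ->
  lex_feasible B -> lex_min B j l -> 0 < dot w (direction A B j) ->
  (lex_rank w (pivoted B j l) < lex_rank w B)%N.
Proof.
move=> Bu nBj Blex l_min wz_gt0.
have lt_obj := lex_objective_pivoted Bu nBj Blex l_min wz_gt0.
apply: proper_card; apply/properP; split.
  by apply/fintype.subsetP => B'; rewrite !inE; apply: lt_trans.
by exists (pivoted B j l); rewrite !inE // ltxx.
Qed.

End LexPivot.

End Pivoting.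

(** * Lexicographically positive starting tableaus and Phase 1 *)

Section SlimShadow.
Variables (R : realType) (m n p : nat).
Variables (A : 'M[R]_(m, n)) (b : 'cV[R]_m) (D : 'M[R]_(p, n)) (d : 'cV[R]_p).
Variable c : 'cV[R]_n.
Hypothesis nonneg : forall j : 'I_n, exists i : 'I_p, nonneg_row D d i j.
Hypothesis P01 : zero_one_polytope (polyhedron A b D d).

Local Notation q := #|slack_rows D d|.
Local Notation SA := (std_A A D d).
Local Notation Sb := (std_b b D d).
Local Notation P := (polyhedron A b D d).
Local Notation pivots := (@pivot R m n p A b D d).
Implicit Types (B : std_basis m D d) (j : 'I_(n + q)) (l : 'I_(m + q)).
Implicit Types (v w : 'cV[R]_n) (s : 'S_(n + q)).

Lemma vertex_zero_one B : feasible_basis A b B -> zero_one_vector (vertex A b B).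
Proof. by move=> Bf; apply: P01.2; apply: vertex_extreme. Qed.

Lemma pivotE B j l B' : pivot A b B j l B' ->
  [/\ feasible_basis A b B, nonbasic B j, min_ratio A b B j l & B' = pivoted B j l].
Proof. by []. Qed.

(** A positive basic value settles its row at the column [b']; at a degenerate position that entry
    is 0 and the rest of the row decides. *)
Lemma lex_feasible_of_rows B K (Y : 'M[R]_(m + q, K)) : feasible_basis A b B ->
  (forall i, lex_pos (row i (basis_coords A B Y))) -> lex_feasible A b Y B.
Proof.
move=> [Bu x_ge0] Ypos i.
have row_first (h : 'I_(1 + K)) : h = 0%N :> nat ->
    row i (basis_coords A B (row_mx Sb Y)) 0 h = basic_solution A b B (B i) 0.
  move=> h0; have -> : h = lshift K 0 by apply: val_inj.
  by rewrite mxE row0_coords.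
have row_next k : row i (basis_coords A B (row_mx Sb Y)) 0 (rshift 1 k) =
    row i (basis_coords A B Y) 0 k.
  by rewrite mxE /basis_coords mul_mx_row row_mxEr [RHS]mxE.
have [x0|x_gt0] := eqVneq (basic_solution A b B (B i) 0) 0; last first.
  by exists (lshift K 0) => [//|]; rewrite row_first // lt_neqAle eq_sym x_gt0 x_ge0.
have [k Yk0 Yk] := Ypos i; exists (rshift 1 k) => [h|]; last by rewrite row_next.
rewrite -[h]splitK; case: (split h) => h' /= lt_h.
  by rewrite row_first //= ord1.
by rewrite row_next Yk0.
Qed.

Lemma lex_feasible_basis_mx B : feasible_basis A b B ->
  lex_feasible A b (basis_mx A B) B.
Proof.
move=> Bf; apply: lex_feasible_of_rows => // i.
rewrite /basis_coords mulVmx; last by case: Bf.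
exists i => [k lt_ki|]; rewrite !mxE ?eqxx //.
by case: eqP lt_ki => // ->; rewrite ltnn.
Qed.

Lemma lex_feasible_basis_first s B : feasible_basis A b B -> basis_first s B ->
  lex_feasible A b (col_perm s SA) B.
Proof.
move=> Bf Bs; have [Bu _] := Bf; apply: lex_feasible_of_rows => // i.
have coordsE k i' : s k = B i' ->
    row i (basis_coords A B (col_perm s SA)) 0 k = (i == i')%:R.
  move=> eqk; transitivity (basis_coords A B (basis_mx A B) i i').
    rewrite mxE.
    transitivity (col k (basis_coords A B (col_perm s SA)) i 0).
      by rewrite [RHS]mxE.
    transitivity (col i' (basis_coords A B (basis_mx A B)) i 0); last by rewrite mxE.
    rewrite !basis_coords_col; congr (basis_coords A B _ i 0).
    by apply/colP => h; rewrite !mxE eqk.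
  by rewrite /basis_coords mulVmx // mxE.
pose k := (s^-1)%g (B i).
have sk : s k = B i by rewrite permKV.
exists k => [k' lt_k'|]; last by rewrite (coordsE _ i) // eqxx.
(* All columns before that of [B i] are basic, so they are unit vectors with entry 0 in row [i]. *)
have : s k' \in codom B.
  by rewrite Bs (ltn_trans lt_k') // -Bs sk codom_f.
case/codomP => i' eqk'; rewrite (coordsE _ i') //.
case: eqP => // eq_i; move: lt_k'.
by rewrite (_ : k' = k) ?ltnn //; apply: (@perm_inj _ s); rewrite eqk' sk eq_i.
Qed.

Lemma row_free_mull a h k (Y : 'M[R]_(a, h)) (Z : 'M[R]_(h, k)) :
  row_free (Y *m Z) -> row_free Y.
Proof.
by rewrite -!row_leq_rank => /leq_trans; apply; apply: mxrankM_maxl.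
Qed.

Lemma row_free_basis_mx B : is_basis A B -> row_free (row_mx Sb (basis_mx A B)).
Proof.
move=> Bu; apply: (@row_free_mull _ _ _ _ (col_mx 0 1%:M)).
by rewrite mul_row_col mulmx0 add0r mulmx1 row_free_unit.
Qed.

(** Selecting the columns of [B], found at positions [s^-1 (B i)], recovers the invertible
    [A'_B]. *)
Lemma row_free_col_perm s B : is_basis A B -> row_free (row_mx Sb (col_perm s SA)).
Proof.
move=> Bu.
apply: (@row_free_mull _ _ _ _ (col_mx 0 (colsub (fun i => (s^-1)%g (B i)) 1%:M))).
rewrite mul_row_col mulmx0 add0r mulmx_colsub mulmx1.
suff -> : colsub (fun i => (s^-1)%g (B i)) (col_perm s SA) = basis_mx A B.
  by rewrite row_free_unit.
by apply/matrixP => i k; rewrite !mxE permKV.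
Qed.

Lemma slim_condition_of_stops v B (lam : R) : is_basis A B -> 0 < lam ->
  simplex_stops A (c - lam *: v) B -> slim_condition A c v B.
Proof.
move=> Bu lam_gt0 stop z /cone_lift[y [y0 <- y_ge0]] cz_gt0.
have : dot (c - lam *: v) (usubmx y) <= 0.
  rewrite (dot_ker _ Bu y0); apply: sumr_le0 => k nBk.
  by apply: mulr_ge0_le0; [exact: y_ge0 | exact: stop].
rewrite dotBl dotZl subr_le0 => /(lt_le_trans cz_gt0).
by rewrite pmulr_rgt0.
Qed.

Lemma run_feasible step B0 k B :
  (forall B j l B', step B j l B' -> pivot A b B j l B') ->
  feasible_basis A b B0 -> run A b step B0 k B -> feasible_basis A b B.
Proof.
by move=> sub Bf; elim=> // {}k B1 j l B2 _ B1f /sub/pivotE[_ nj min_l ->] _;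
  apply: feasible_pivoted.
Qed.

(* If the starting vertex already maximizes w, a run of the lexicographic method
   for w must consist of degenerate pivots only. *)
Lemma degenerate_run w B0 : feasible_basis A b B0 ->
  (forall B, feasible_basis A b B -> dot w (vertex A b B - vertex A b B0) <= 0) ->
  exists B1, run A b pivots B0 0 B1 /\ simplex_stops A w B1.
Proof.
move=> B0f w_max; pose Y := basis_mx A B0.
have Yfree : row_free (row_mx Sb Y) by apply: row_free_basis_mx; case: B0f.
suff main N B : (lex_rank A b Y w B < N)%N -> feasible_basis A b B ->
    lex_feasible A b Y B -> vertex A b B = vertex A b B0 ->
    run A b pivots B0 0 B ->
    exists B1, run A b pivots B0 0 B1 /\ simplex_stops A w B1.
  apply: (main (lex_rank A b Y w B0).+1 B0) => //; last exact: run_nil.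
  exact: lex_feasible_basis_mx.
elim: N B => // N IHN B rank_B Bf Blex Bx0 runB; have [Bu _] := Bf.
have [/existsP[j /andP[nBj wz_gt0]]|/existsPn no_j] :=
    boolP [exists j, nonbasic B j && (0 < dot w (direction A B j))]; last first.
  exists B; split=> // j nBj; rewrite leNgt.
  by have := no_j j; rewrite nBj.
have [l0 ul0] := exists_leaving P01.1 Bf nBj wz_gt0.
have [l l_min] := lex_min_exists b Y ul0.
have l_ratio := lex_min_ratio Bu l_min; have [ul_gt0 _] := l_ratio.
have ul_neq0 : pivot_column A B j l 0 != 0 by rewrite gt_eqF.
have B'f := feasible_pivoted Bf nBj l_ratio.
(* The direction strictly improves [w], so a positive step would exceed the maximum in [w_max]. *)
have step0 : step_length A b B j l = 0.
  apply/eqP; rewrite eq_le step_length_ge0 // andbT.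
  have := w_max _ B'f; rewrite vertex_pivoted // Bx0 addrAC subrr add0r dotZr.
  by rewrite pmulr_lle0.
apply: (IHN (pivoted B j l)) => //.
- by rewrite -ltnS (leq_trans _ rank_B) // ltnS; apply: lex_rank_pivoted.
- exact: lex_feasible_pivoted.
- by rewrite vertex_pivoted // step0 scale0r addr0.
- apply: (run_degenerate runB (j := j) (l := l)) => //.
  by move/(non_degenerate_step Bu nBj ul_gt0); rewrite step0 ltxx.
Qed.

Lemma phase1_exists B0 : feasible_basis A b B0 -> exists B1, phase1 A b c B0 B1.
Proof.
move=> B0f; set v := slim_v A b B0.
have [cond|no_cond] := boolp.EM (slim_condition A c v B0).
  by exists B0; left.
(* The constant of [dot_le_hamming]; the summand 1 keeps it positive even when [c = 0]. *)
pose lam := 1 + \sum_j `|c j 0|.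
have lam_gt0 : 0 < lam by rewrite ltr_pwDl // sumr_ge0.
have [B1 [runB1 stopB1]] : exists B1, run A b pivots B0 0 B1 /\
    simplex_stops A (c - lam *: v) B1.
  apply: degenerate_run => // B Bf; rewrite dotBl dotZl subr_le0.
  exact: dot_le_hamming (vertex_zero_one B0f) (vertex_zero_one Bf).
have [B1u _] : feasible_basis A b B1 by apply: run_feasible B0f runB1.
by exists B1; right; split=> //; apply: slim_condition_of_stops stopB1.
Qed.

(** * Phase 2: persistence of the slim condition, termination and the pivot count *)

Lemma slim_condition_pivoted v B j l : is_basis A B -> slim_condition A c v B ->
  slim_entering A c v B j -> slim_condition A c v (pivoted B j l).
Proof.
move=> Bu slimB [[nBj cj_gt0] ratio_max].
pose cz k := dot c (direction A B k); pose vz k := dot v (direction A B k).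
have vj_gt0 : 0 < vz j by apply: slimB => //; apply: direction_cone.
pose lam := cz j / vz j.
have lam_gt0 : 0 < lam by rewrite divr_gt0.
have reduced k : nonbasic B k -> cz k - lam * vz k <= 0.
  move=> nBk; have [ck_le0|ck_gt0] := leP (cz k) 0; last first.
    have vk_gt0 : 0 < vz k by apply: slimB => //; apply: direction_cone.
    have [_] := ratio_max k (conj nBk ck_gt0).
    by rewrite ler_pdivrMr // subr_le0.
  have [vk_ge0|vk_lt0] := leP 0 (vz k).
    by rewrite subr_le0 (le_trans ck_le0) // mulr_ge0 // ltW.
  (* The case [c z^k <= 0], [v z^k < 0]. This combination lies in the cone and [v] vanishes on it,
     so the slim condition forces [c y <= 0]; dividing by [v z^j] gives the bound. *)
  pose y := - vz k *: std_direction A B j + vz j *: std_direction A B k.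
  have yE w : dot w (usubmx y) =
      - vz k * dot w (direction A B j) + vz j * dot w (direction A B k).
    by rewrite linearD !linearZ dotDr !dotZr.
  have cone_y : basic_cone A B (usubmx y).
    apply: cone_std => [|h nBh].
      by rewrite mulmxDr -!scalemxAr !std_direction_ker // !scaler0 addr0.
    rewrite mxE [X in X + _]mxE [X in _ + X]mxE !std_direction_nonbasic //.
    by rewrite addr_ge0 // mulr_ge0 // ?ler0n // ?oppr_ge0 ltW.
  have : dot c (usubmx y) <= 0.
    rewrite leNgt; apply/negP => /(slimB _ cone_y).
    by rewrite yE -/(vz j) -/(vz k) mulrC mulrN addNr ltxx.
  rewrite yE -/(cz j) -/(cz k) -(pmulr_rle0 _ vj_gt0) => le0.
  rewrite -(pmulr_rle0 _ vj_gt0).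
  have -> : vz j * (cz k - lam * vz k) = - vz k * cz j + vz j * cz k.
    by rewrite /lam; field; rewrite gt_eqF.
  by rewrite -(pmulr_rle0 _ vj_gt0).
move=> z /cone_lift[y [y0 <- y_ge0]] cz_gt0.
have : dot (c - lam *: v) (usubmx y) <= 0.
  (* An old nonbasic [k] other than [j] stays nonbasic, so [y_k >= 0]. The coordinate [y_j] may be
     negative, but its reduced cost for [c - lam v] is 0. *)
  rewrite (dot_ker _ Bu y0); apply: sumr_le0 => k nBk.
  rewrite dotBl dotZl; have [->|ne_kj] := eqVneq k j.
    by rewrite -/(cz j) -/(vz j) divfK ?subrr ?mulr0 // gt_eqF.
  by apply: mulr_ge0_le0; [exact/y_ge0/nonbasic_pivoted | exact: reduced].
rewrite dotBl dotZl subr_le0 => /(lt_le_trans cz_gt0).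
by rewrite pmulr_rgt0.
Qed.

Lemma lex_rowE s B j i : lex_row A b s B j i =
  lex_tuple ((pivot_column A B j i 0)^-1 *:
    row i (basis_coords A B (row_mx Sb (col_perm s SA)))).
Proof.
apply: eq_from_tnth => k; rewrite !tnth_mktuple [RHS]mxE.
by congr (_ * _); rewrite [RHS]mxE.
Qed.

Definition slim_invariant v s B : Prop :=
  [/\ feasible_basis A b B, lex_feasible A b (col_perm s SA) B
    & slim_condition A c v B].

Lemma slim_pivotE v s B j l B' : slim_pivot A b c v s B j l B' ->
  [/\ nonbasic B j, lex_min A b (col_perm s SA) B j l, slim_entering A c v B j
    & B' = pivoted B j l].
Proof.
move=> [/pivotE[_ nBj _ ->] ent [ul l_min]]; split=> //; split=> // i ui.
by rewrite -!lex_rowE l_min.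
Qed.

Lemma slim_invariant_step v s B j l B' : slim_invariant v s B ->
  slim_pivot A b c v s B j l B' -> slim_invariant v s B'.
Proof.
move=> [Bf Blex Bslim] /slim_pivotE[nBj l_min ent ->]; have [Bu _] := Bf; split.
- by apply: feasible_pivoted => //; apply: lex_min_ratio l_min.
- by apply: lex_feasible_pivoted => //; apply: row_free_col_perm Bu.
- exact: slim_condition_pivoted.
Qed.

Lemma slim_step_exists v s B : slim_invariant v s B -> ~ simplex_stops A c B ->
  exists j l B', slim_pivot A b c v s B j l B'.
Proof.
move=> [Bf Blex Bslim] nstop; have [Bu _] := Bf.
pose imp k := nonbasic B k && (0 < dot c (direction A B k)).
have [/existsP[j0 imp0]|/existsPn no_j] := boolP [exists j, imp j]; last first.
  case: nstop => j nBj; rewrite leNgt.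
  by have := no_j j; rewrite /imp nBj.
case: (@arg_maxP _ R _ j0 imp
  (fun k => dot c (direction A B k) / dot v (direction A B k)) imp0).
move=> j /andP[nBj cj_gt0] j_max.
have [l0 ul0] := exists_leaving P01.1 Bf nBj cj_gt0.
have [l l_min] := lex_min_exists b (col_perm s SA) ul0.
exists j, l, (pivoted B j l); split.
- by split=> //; apply: lex_min_ratio l_min.
- split=> // k [nBk ck_gt0]; split; last by apply: j_max; rewrite /imp nBk.
  (* The slim condition makes the denominator of every improving ratio positive. *)
  by rewrite gt_eqF //; apply: Bslim => //; apply: direction_cone.
- by split=> [|i ui]; [exact: l_min.1 | rewrite !lex_rowE l_min.2].
Qed.

(** Every entering index has positive reduced cost for [c], so [lex_rank] for the fixed objective
    [c] drops at each pivot, whatever ratios are attained. *)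
Lemma slim_no_infinite_run v s (B : nat -> std_basis m D d) :
  slim_invariant v s (B 0%N) ->
  ~ (forall t, exists j l, slim_pivot A b c v s (B t) j l (B t.+1)).
Proof.
move=> inv0 steps; pose rank t := lex_rank A b (col_perm s SA) c (B t).
have inv t : slim_invariant v s (B t).
  elim: t => // t IHt; have [j [l step]] := steps t.
  exact: slim_invariant_step step.
have rank_lt t : (rank t.+1 < rank t)%N.
  have [j [l /slim_pivotE[nBj l_min [[_ cj_gt0] _] eqB]]] := steps t.
  have [[Bu _] Blex _] := inv t.
  by rewrite /rank eqB; apply: lex_rank_pivoted.
have rank_le t : (rank t + t <= rank 0)%N.
  elim: t => [|t IHt]; first by rewrite addn0.
  by apply: leq_trans IHt; rewrite addnS -addSn leq_add2r.
by have := rank_le (rank 0%N).+1; rewrite leqNgt ltn_addl.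
Qed.

(** The Hamming distance to the starting vertex, rather than [n], is the inductive bound: a
    non-degenerate pivot raises both sides. *)
Lemma slim_run B0 s B1 k B : feasible_basis A b B0 ->
  slim_invariant (slim_v A b B0) s B1 ->
  run A b (slim_pivot A b c (slim_v A b B0) s) B1 k B ->
  slim_invariant (slim_v A b B0) s B /\
  (k <= #|[set j | vertex A b B j 0%R != vertex A b B0 j 0%R]|)%N.
Proof.
move=> B0f inv1; set v := slim_v A b B0.
pose N B := #|[set j | vertex A b B j 0 != vertex A b B0 j 0]|.
have dist_pivot B2 j l B3 :
    slim_invariant v s B2 -> slim_pivot A b c v s B2 j l B3 ->
    [/\ (N B2 <= N B3)%N & non_degenerate A b B2 j -> (N B2 < N B3)%N].
  move=> inv2 step; have inv3 := slim_invariant_step inv2 step.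
  have [B3f _ _] := inv3; have [B2f _ slim2] := inv2; have [B2u _] := B2f.
  have [nBj l_min [[_ cj_gt0] _] eqB] := slim_pivotE step.
  have l_ratio := lex_min_ratio B2u l_min; have [ul _] := l_ratio.
  have vj_gt0 : 0 < dot v (direction A B2 j).
    by apply: slim2 => //; apply: direction_cone.
  (* Both distances are values of [v] on displacements from the starting vertex, so they differ by
     the step length times [v z^j]. *)
  have NE : (N B3)%:R = (N B2)%:R + step_length A b B2 j l * dot v (direction A B2 j).
    rewrite /N -!dot_hamming; try exact: vertex_zero_one.
    by rewrite eqB vertex_pivoted ?gt_eqF // addrAC [LHS]dotDr dotZr.
  split=> [|/(non_degenerate_step B2u nBj ul) step_gt0].
    by rewrite -(ler_nat R) NE lerDl mulr_ge0 ?step_length_ge0 // ltW.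
  by rewrite -(ltr_nat R) NE ltrDl mulr_gt0.
elim=> [|{}k B2 j l B3 _ [inv2 le_k] step _|{}k B2 j l B3 _ [inv2 le_k] step nd] //.
- have [le_N _] := dist_pivot _ _ _ _ inv2 step.
  by split; [exact: slim_invariant_step step | exact: leq_trans le_N].
- have [_ /(_ nd) lt_N] := dist_pivot _ _ _ _ inv2 step.
  by split; [exact: slim_invariant_step step | exact: leq_ltn_trans lt_N].
Qed.

End SlimShadow.

Theorem theorem2 (R : realType) (m n p : nat)
    (A : 'M[R]_(m, n)) (b : 'cV[R]_m) (D : 'M[R]_(p, n)) (d : 'cV[R]_p)
    (c : 'cV[R]_n)
    (A_int : A \is a mxOver Num.int) (b_int : b \is a mxOver Num.int)
    (D_int : D \is a mxOver Num.int) (d_int : d \is a mxOver Num.int)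
    (c_int : c \is a mxOver Num.int)
    (A_rank : row_free A)
    (nonneg : forall j : 'I_n, exists i : 'I_p, nonneg_row D d i j)
    (P01 : zero_one_polytope (polyhedron A b D d))
    (B0 : std_basis m D d) (B0_feasible : feasible_basis A b B0) :
  (exists B1, phase1 A b c B0 B1) /\
  forall (B1 : std_basis m D d) (s : 'S_(n + #|slack_rows D d|)),
    phase1 A b c B0 B1 -> basis_first s B1 ->
    let step := slim_pivot A b c (slim_v A b B0) s in
    [/\ ~ (exists B : nat -> std_basis m D d, B 0%N = B1 /\
             forall t, exists j l, step (B t) j l (B t.+1)),
        (forall k B, run A b step B1 k B -> ~ simplex_stops A c B ->
           exists j l B', step B j l B'),
        (forall k B, run A b step B1 k B -> simplex_stops A c B ->
           optimal_solution (polyhedron A b D d) c (vertex A b B))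
      & (forall k B, run A b step B1 k B -> (k <= n)%N)].
Proof.
split; first exact: phase1_exists.
move=> B1 s ph1 Bs step.
(* Phase 1 preserves feasibility and ends in the slim condition; placing the columns of [B1] first
   makes the tableau rows lexicographically positive. *)
have inv1 : slim_invariant A b c (slim_v A b B0) s B1.
  have [B1f slim1] : feasible_basis A b B1 /\ slim_condition A c (slim_v A b B0) B1.
    case: ph1 => [[slim0 ->] //|[_ runB1 slim1]].
    by split=> //; apply: run_feasible B0_feasible runB1.
  by split=> //; apply: lex_feasible_basis_first.
split.
- move=> [B [B_0 steps]].
  by apply: (slim_no_infinite_run _ steps); rewrite B_0.
- move=> k B runB; apply: slim_step_exists => //.
  exact: (slim_run nonneg P01 B0_feasible inv1 runB).1.
- move=> k B runB; apply: stops_optimal => //.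
  by have [[Bf _ _] _] := slim_run nonneg P01 B0_feasible inv1 runB.
- move=> k B runB; have [_ le_k] := slim_run nonneg P01 B0_feasible inv1 runB.
  by rewrite (leq_trans le_k) // -[leqRHS]card_ord max_card.
Qed.
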